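(* Let $K$ be a field of characteristic zero, let $L$ be a linear functional on $K[x]$, and let $\big(p_n(x)\big)_{n\ge0}$ be a sequence of monic polynomials over $K$ with $\deg p_n(x)=n$ that are orthogonal with respect to $L$, i.e., $L(p_m(x)p_n(x))=\omega_n\delta_{m,n}$ for all $m,n\ge 0$, with $\omega_n\neq 0$ for all $n$. Write $\mu_n=L(x^n)$ for the $n$-th moment of $L$. Let $n$ and $d$ be non-negative integers, and let $x_1,x_2,\dots,x_d$ be variables. Then, using the umbral notation $\mu^k\equiv\mu_k$, $$ \frac {\det\limits_{0\le i,j\le n-1}\left(\mu^{i+j}\prod _{\ell=1} ^{d}(x_\ell+\mu)\right)} {\det\limits_{0\le i,j\le n-1}\left(\mu_{i+j}\right)} =(-1)^{nd}\, \frac {\det\limits_{1\le i,j\le d}\left(p_{n+i-1}(-x_j)\right)} {\prod\limits _{1\le i<j\le d}(x_i-x_j)}. $$ Here, determinants of empty matrices and empty products are understood to equal $1$.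
   Context: Umbral notation: an expression that is a polynomial in the symbol $\mu$ is expanded out, and then every occurrence of $\mu^k$ is replaced by the moment $\mu_k$ (with $\mu^0$ replaced by $\mu_0$). For example, $\mu^2(x_1+\mu)(x_2+\mu)$ means $x_1x_2\mu_2+(x_1+x_2)\mu_3+\mu_4$. This replacement is carried out separately in each matrix entry, before the determinant is taken. The symbol $\delta_{m,n}$ is the Kronecker delta. Under the stated assumptions the Hankel determinants $\det_{0\le i,j\le n-1}(\mu_{i+j})$ are non-zero. *)

(* Defs.v *)
From mathcomp Require Import all_boot all_order all_algebra.
From mathcomp Require Import mpoly.

Set Implicit Arguments.
Unset Strict Implicit.
Unset Printing Implicit Defensive.

Import GRing.Theory.
Local Open Scope ring_scope.

Definition moment (K : fieldType) (L : {scalar {poly K}}) (n : nat) : K :=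
  L 'X^n.

(* A polynomial in the umbral symbol, with coefficients in the polynomial ring
   in the variables x_1, ..., x_d, is an element of {poly {mpoly K[d]}}: its
   indeterminate 'X is the symbol, and the k-th power of 'X is replaced by the
   constant mu k. *)
Definition umbral (K : fieldType) (d : nat) (mu : nat -> K)
    (q : {poly {mpoly K[d]}}) : {mpoly K[d]} :=
  \sum_(k < size q) q`_k * (mu k)%:MP.

(* Main.v *)
(* Put y_l = - x_l and q = prod_l (X - y_l), and let A be the square matrix of
   size n + d whose row k is (mu_k, ..., mu_(k+n-1), y_1^k, ..., y_d^k), i.e. the
   values at X^k of the n functionals f |-> L(f X^j) and of the d evaluations at
   the y_l. Replacing the X^k by another monic basis of consecutive degrees does
   not change det A. With the basis p_k, orthogonality makes A block triangular,
   so det A is the Hankel determinant times det (p_(n+i-1)(y_j)). With the basis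
   1, ..., X^(d-1), q, q X, ..., q X^(n-1), the last n rows vanish at the y_l, so
   up to the sign of the block exchange det A is the modified Hankel determinant
   times a Vandermonde determinant. *)
Require Import Defs.
From mathcomp Require Import all_boot all_order all_algebra all_fingroup.
From mathcomp Require Import mpoly.

Set Implicit Arguments.
Unset Strict Implicit.
Unset Printing Implicit Defensive.

Import GRing.Theory.
Local Open Scope ring_scope.

(** * Change of basis, rotation of rows, and moment forms over a commutative ring *)

Section DegreeBasis.
Variable R : comNzRingType.
Implicit Types (b : nat -> {poly R}) (mu : nat -> R) (q : {poly R}).

(** Change of basis matrix: its product with a matrix listing values of functionals at the ['X^k]
    lists their values at the [b i], when [b i] has degree [i]. *)
Definition coef_mx b N : 'M[R]_N := \matrix_(i, k) (b i)`_k.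

Lemma det_coef_mx b N :
  (forall k, b k \is monic) -> (forall k, size (b k) = k.+1) ->
  \det (coef_mx b N) = 1.
Proof.
move=> b_monic b_size; rewrite det_trig; last first.
  by apply/is_trig_mxP => i j ltij; rewrite mxE nth_default // b_size.
apply: big1 => i _; rewrite mxE.
by have /monicP := b_monic i; rewrite lead_coefE b_size.
Qed.

Lemma horner_coef_mx b N m (y : 'I_m -> R) :
  (forall k, size (b k) = k.+1) ->
  coef_mx b N *m \matrix_(k < N, l < m) y l ^+ k = \matrix_(i, l) (b i).[y l].
Proof.
move=> b_size; apply/matrixP => i l; rewrite !mxE (@horner_coef_wide _ N).
  by apply: eq_bigr => k _; rewrite !mxE.
by rewrite b_size.
Qed.

(** Rotating the rows by one place is a cycle of length [m.+1], of sign [(-1) ^+ m]; iterate [r]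
    times. *)
Lemma det_row_rotation (F : nat -> nat -> R) m r :
  \det (\matrix_(i < m.+1, j < m.+1) F ((i + r) %% m.+1)%N j)
  = (-1) ^+ (r * m) * \det (\matrix_(i < m.+1, j < m.+1) F i j).
Proof.
elim: r F => [|r IHr] F.
  rewrite mul0n mul1r; congr (\det _).
  by apply/matrixP => i j; rewrite !mxE addn0 modn_small.
rewrite mulSn exprD -mulrA -IHr.
(* Sending the last index to 0 and keeping the order of the others is the cyclic shift; its parity
   is that of [m]. *)
pose s : 'S_m.+1 := lift_perm ord_max ord0 1.
have sE i : s i = (i.+1 %% m.+1)%N :> nat.
  case: (unliftP ord_max i) => [k|] ->.
    rewrite lift_perm_lift perm1 lift0 lift_max modn_small //.
    by rewrite ltnS.
  by rewrite lift_perm_id /= modnn.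
rewrite -[X in X * _](_ : \det (perm_mx s) = _); last first.
  by rewrite det_perm odd_lift_perm odd_perm1 /= addbF addbF signr_odd.
rewrite -det_mulmx -row_permE; congr (\det _).
by apply/matrixP => i j; rewrite !mxE sE modnDml addSnnS.
Qed.

(* [umbral], stated over an arbitrary commutative ring of coefficients. *)
Definition moment_form mu q : R := \sum_(k < size q) q`_k * mu k.

(** Coefficients beyond the size are zero, so the range can be fixed independently of [q], as a
    matrix product requires. *)
Lemma moment_formMXn mu q j N : (size q <= N)%N ->
  moment_form mu (q * 'X^j) = \sum_(k < N) q`_k * mu (k + j)%N.
Proof.
move=> leqN; pose f k := (q * 'X^j)`_k * mu k.
have -> : moment_form mu (q * 'X^j) = \sum_(k < j + N) f k.
  have le_size : (size (q * 'X^j)%R <= j + N)%N.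
    apply: leq_trans (size_polyMleq _ _) _.
    by rewrite size_polyXn addnS /= addnC leq_add2l.
  rewrite /moment_form (big_ord_widen _ f le_size) big_mkcond /=.
  apply: eq_bigr => k _; case: ltnP => // le_k.
  by rewrite /f nth_default ?mul0r.
rewrite big_split_ord /= big1 => [|k _]; last first.
  by rewrite /f coefMXn ltn_ord mul0r.
rewrite add0r; apply: eq_bigr => k _.
by rewrite /f coefMXn ltnNge leq_addr /= addKn addnC.
Qed.

Lemma moment_form_coef_mx mu b N n :
  (forall k, size (b k) = k.+1) ->
  coef_mx b N *m \matrix_(k < N, j < n) mu (k + j)%N
  = \matrix_(i, j) moment_form mu (b i * 'X^j).
Proof.
move=> b_size; apply/matrixP => i j; rewrite !mxE (@moment_formMXn _ _ _ N).
  by apply: eq_bigr => k _; rewrite !mxE.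
by rewrite b_size.
Qed.

(** * Two evaluations of the determinant of moments and point evaluations *)

Section Christoffel.
Variables (mu : nat -> R) (P : nat -> {poly R}) (n d : nat) (y : 'I_d -> R).
Hypothesis P_monic : forall k, P k \is monic.
Hypothesis P_size : forall k, size (P k) = k.+1.
Hypothesis P_orth : forall k j, (j < k)%N -> moment_form mu (P k * 'X^j) = 0.

Let A : 'M[R]_(n + d) :=
  row_mx (\matrix_(k < n + d, j < n) mu (k + j)%N)
         (\matrix_(k < n + d, l < d) y l ^+ k).

Lemma det_orthogonal_rows :
  \det A = \det (\matrix_(i < n, j < n) mu (i + j)%N)
           * \det (\matrix_(i < d, j < d) (P (n + i)%N).[y j]).
Proof.
rewrite -[LHS]mul1r -(det_coef_mx (n + d) P_monic P_size) -det_mulmx.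
rewrite mul_mx_row moment_form_coef_mx // horner_coef_mx //.
set B := row_mx _ _.
have -> : B = block_mx (\matrix_(i < n, j < n) moment_form mu (P i * 'X^j))
    (\matrix_(i < n, l < d) (P i).[y l])
    0 (\matrix_(i < d, j < d) (P (n + i)%N).[y j]).
  rewrite block_mxEh; congr row_mx; apply/matrixP => i j;
    case: (split_ordP i) => k ->; rewrite ?col_mxEu ?col_mxEd !mxE //=.
  by apply: P_orth; apply: leq_trans (ltn_ord j) (leq_addr _ _).
rewrite det_ublock; congr (_ * _).
(* The upper left block is again a coefficient matrix, of determinant 1, times the Hankel matrix. *)
by rewrite -moment_form_coef_mx // det_mulmx det_coef_mx // mul1r.
Qed.

Let q : {poly R} := \prod_(l < d) ('X - (y l)%:P).

Lemma det_divisible_rows :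
  \det A = (-1) ^+ (n * d)
    * (\det (\matrix_(i < n, j < n) moment_form mu (q * 'X^(i + j)))
       * \prod_(i < d) \prod_(j < d | (i < j)%N) (y j - y i)).
Proof.
have q_monic : q \is monic by exact: monic_prod_XsubC.
have q_size : size q = d.+1.
  by rewrite size_prod_XsubC /index_enum -enumT size_enum_ord.
have [nd0|nd_gt0] := posnP (n + d)%N.
  (* The rotation below is taken modulo [n + d], which must be positive. *)
  move: nd0 (A) q y => /eqP; rewrite addn_eq0 => /andP[/eqP -> /eqP ->] B q' y'.
  by rewrite !det_mx00 big_ord0 !mulr1.
pose b k : {poly R} := if (k < d)%N then 'X^k else q * 'X^(k - d).
have b_monic k : b k \is monic.
  rewrite /b; case: ifP => _; first exact: monicXn.
  by rewrite monicMr ?monicXn.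
have b_size k : size (b k) = k.+1.
  rewrite /b; case: ltnP => lekd; first exact: size_polyXn.
  rewrite size_Mmonic ?monicXn ?monic_neq0 // q_size size_polyXn.
  by rewrite addnS /= addSn subnKC.
(* Rotating by [d] puts the multiples of [q] on top, where they vanish at the [y l], so that
   [rot *m A] is block lower triangular. *)
pose rot := \matrix_(i < n + d, k < n + d) (b ((i + d) %% (n + d))%N)`_k.
have det_rot : \det rot = (-1) ^+ (n * d).
  have := det_coef_mx (n + d) b_monic b_size; rewrite /rot /coef_mx.
  rewrite -(prednK nd_gt0) (det_row_rotation (fun i k => (b i)`_k)) => ->.
  (* The exponent d(n + d - 1) differs from nd by the even number d(d - 1). *)
  rewrite mulr1 -signr_odd -[RHS]signr_odd; congr ((-1) ^+ (nat_of_bool _)).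
  rewrite mulnC; case: {+}d nd_gt0 => [|d' _]; first by rewrite !muln0.
  by rewrite addnS /= mulnDl oddD [odd (d' * _)]oddM /= andbN addbF.
have rotE : rot *m A = block_mx
    (\matrix_(i < n, j < n) moment_form mu (q * 'X^(i + j))) 0
    (\matrix_(i < d, j < n) mu (i + j)%N) (\matrix_(i < d, l < d) y l ^+ i).
  have rot_entry m (C : 'M[R]_(n + d, m)) i j :
      (rot *m C) i j = (coef_mx b (n + d) *m C)
                         (Ordinal (ltn_pmod (i + d) nd_gt0)) j.
    by rewrite !mxE; apply: eq_bigr => k _; rewrite !mxE.
  have bL (i : 'I_n) : b ((i + d) %% (n + d))%N = q * 'X^i.
    by rewrite modn_small ?ltn_add2r // /b ltnNge leq_addl addnK.
  have bR (i : 'I_d) : b ((n + i + d) %% (n + d))%N = 'X^i.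
    rewrite addnAC modnDl modn_small ?ltn_addl //.
    by rewrite /b ltn_ord.
  rewrite mul_mx_row block_mxEh; congr row_mx; apply/matrixP => i j;
    rewrite rot_entry ?moment_form_coef_mx ?horner_coef_mx // mxE /=;
    case: (split_ordP i) => k ->; rewrite ?col_mxEu ?col_mxEd !mxE /= ?bL ?bR.
  - by rewrite -mulrA -exprD.
  - rewrite -exprD -[X in moment_form _ X]mul1r.
    rewrite (@moment_formMXn _ _ _ 1) ?size_poly1 //.
    by rewrite big_ord1 coef1 mul1r.
  - rewrite hornerM horner_prod (bigD1 j) //= hornerXsubC subrr.
    by rewrite !mul0r.
  by rewrite hornerXn.
have := congr1 (@determinant _ _) rotE.
rewrite det_mulmx det_rot det_lblock => detE.
have <- : \det (\matrix_(i < d, l < d) y l ^+ i)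
          = \prod_(i < d) \prod_(j < d | (i < j)%N) (y j - y i).
  transitivity (\det (Vandermonde d (\row_l y l))).
    by congr (\det _); apply/matrixP => i l; rewrite !mxE.
  rewrite det_Vandermonde; apply: eq_bigr => i _; apply: eq_bigr => j _.
  by rewrite !mxE.
by rewrite -detE mulrA -exprMn mulrNN mul1r expr1n mul1r.
Qed.

(** Equates the two evaluations of [\det A]. The identity is free of division, since neither
    denominator need be invertible in [R]. *)
Lemma christoffel_hankel :
  \det (\matrix_(i < n, j < n) moment_form mu (q * 'X^(i + j)))
    * \prod_(i < d) \prod_(j < d | (i < j)%N) (y j - y i)
  = (-1) ^+ (n * d)
    * (\det (\matrix_(i < n, j < n) mu (i + j)%N)
       * \det (\matrix_(i < d, j < d) (P (n + i)%N).[y j])).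
Proof.
by rewrite -det_orthogonal_rows det_divisible_rows mulrA -exprMn mulrNN mul1r
  expr1n mul1r.
Qed.

End Christoffel.
End DegreeBasis.

(** * Consequences of orthogonality over the field *)

Section Orthogonal.
Variables (K : fieldType) (L : {scalar {poly K}}).
Variables (p : nat -> {poly K}) (omega : nat -> K).
Hypothesis p_monic : forall m : nat, p m \is monic.
Hypothesis p_size : forall m : nat, size (p m) = m.+1.
Hypothesis p_orth : forall m k : nat, L (p m * p k) = omega k * (m == k)%:R.
Hypothesis omega_neq0 : forall m : nat, omega m != 0.

Lemma scalar_moment_form (q : {poly K}) : L q = moment_form (moment L) q.
Proof.
rewrite -{1}[q]coefK poly_def linear_sum.
by apply: eq_bigr => k _; rewrite linearZ.
Qed.

(** Induction on the degree: subtracting the multiple of the [p] of equal degree that cancels the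
    leading term changes nothing, as that multiple is orthogonal to [p k]. *)
Lemma orth_lower_degree k (q : {poly K}) : (size q <= k)%N -> L (p k * q) = 0.
Proof.
have [m] := ubnP (size q); elim: m q => // m IHm q lt_qm le_qk.
have [->|q_neq0] := eqVneq q 0; first by rewrite mulr0 linear0.
set r := q - lead_coef q *: p (size q).-1.
have size_q : (0 < size q)%N by rewrite size_poly_gt0.
have lt_rq : (size r < size q)%N.
  rewrite -[X in (_ < X)%N](prednK size_q) ltnS; apply/leq_sizeP => j.
  rewrite leq_eqVlt => /predU1P[<-|lt_j]; rewrite coefB coefZ.
    have := p_monic (size q).-1; rewrite monicE lead_coefE p_size /= => /eqP ->.
    by rewrite mulr1 lead_coefE subrr.
  rewrite (prednK size_q) in lt_j.
  by rewrite !nth_default ?mulr0 ?subr0 // p_size prednK.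
have -> : q = r + lead_coef q *: p (size q).-1 by rewrite subrK.
rewrite mulrDr -scalerAr linearD linearZ /= p_orth IHm ?add0r.
- rewrite gtn_eqF ?mulr0 //.
  by rewrite prednK.
- by apply: leq_trans lt_rq _.
by apply: leq_trans (ltnW lt_rq) _.
Qed.

(* The Gram matrix of the p_k, which is diagonal, is congruent to the Hankel
   matrix. *)
Lemma det_hankel_neq0 n :
  \det (\matrix_(i < n, j < n) moment L (i + j)%N) != 0.
Proof.
set H := matrix_of_fun _ _; pose T := coef_mx p n.
suff TH : T *m H *m T^T = diag_mx (\row_(i < n) omega i).
  have := congr1 (@determinant _ _) TH.
  rewrite !det_mulmx det_tr det_coef_mx // mul1r mulr1 det_diag => ->.
  by apply/prodf_neq0 => i _; rewrite mxE.
rewrite moment_form_coef_mx //; apply/matrixP => i j; rewrite !mxE.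
transitivity (L (p i * p j)); last first.
  by rewrite p_orth val_eqE; case: eqVneq => [->|]; rewrite ?mulr1 ?mulr0.
rewrite -[p j in RHS]coefK poly_def p_size mulr_sumr linear_sum /=.
have le_jn := ltn_ord j.
pose f k := L (p i * ((p j)`_k *: 'X^k)).
rewrite (big_ord_widen _ f le_jn) [RHS]big_mkcond /=; apply: eq_bigr => k _.
rewrite !mxE -scalar_moment_form /f -scalerAr linearZ /= mulrC.
by case: ltnP => // lt_jk; rewrite nth_default ?mul0r // p_size.
Qed.

End Orthogonal.

(** Cross-multiplication, from a division-free identity in the domain to quotients in its fraction
    field. *)
Lemma tofrac_div_eq (D : idomainType) (a b h v : D) e :
  h != 0 -> v != 0 -> a * v = (-1) ^+ e * (h * b) ->
  tofrac a / tofrac h = (-1) ^+ e * (tofrac b / tofrac v).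
Proof.
move=> h_neq0 v_neq0 eq_av; rewrite mulrA; apply/eqP.
rewrite eqr_div ?tofrac_eq0 // -tofracM eq_av !tofracM tofracXn tofracN.
by rewrite tofrac1 -mulrA [X in _ * X == _]mulrC.
Qed.

(** * Specialization to the variables, with y_l = - x_l *)

Theorem theorem1 (K : fieldType) (charK : [pchar K] =i pred0)
    (L : {scalar {poly K}}) (p : nat -> {poly K}) (omega : nat -> K)
    (p_monic : forall m : nat, p m \is monic)
    (p_size : forall m : nat, size (p m) = m.+1)
    (p_orth : forall m k : nat, L (p m * p k) = omega k * (m == k)%:R)
    (omega_neq0 : forall m : nat, omega m != 0)
    (n d : nat) :
  tofrac (\det (\matrix_(i < n, j < n)
      umbral (moment L) ('X^(i + j)%N * \prod_(l < d) (('X_l)%:P + 'X))))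
    / tofrac ((\det (\matrix_(i < n, j < n) moment L (i + j)%N))%:MP)
  = (-1) ^+ (n * d)
    * (tofrac (\det (\matrix_(i < d, j < d)
          (map_poly (@mpolyC d K) (p (n + i)%N)).[- 'X_j]))
       / tofrac (\prod_(i < d) \prod_(j < d | (i < j)%N) ('X_i - 'X_j)))
    :> {fraction {mpoly K[d]}}.
Proof.
pose R := {mpoly K[d]}.
pose mu k : R := (moment L k)%:MP.
pose y (l : 'I_d) : R := - 'X_l.
pose P k : {poly R} := map_poly (@mpolyC d K) (p k).
have P_monic k : P k \is monic by rewrite monic_map.
have P_size k : size (P k) = k.+1 by rewrite size_map_poly.
have P_orth k j : (j < k)%N -> moment_form mu (P k * 'X^j) = 0.
  (* This moment form is the image under [mpolyC] of [L (p k * 'X^j)], which is zero. *)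
  move=> lt_jk; rewrite (@moment_formMXn _ _ _ _ k.+1) ?P_size //.
  have := orth_lower_degree p_monic p_size p_orth (q := 'X^j) (k := k).
  rewrite size_polyXn => /(_ lt_jk) /(congr1 (@mpolyC d K)).
  rewrite scalar_moment_form (@moment_formMXn _ _ _ _ k.+1) ?p_size //.
  rewrite mpolyC0 rmorph_sum /= => E; rewrite -[RHS]E; apply: eq_bigr => i _.
  by rewrite coef_map rmorphM.
have main := christoffel_hankel n y P_monic P_size P_orth.
apply: tofrac_div_eq.
- rewrite mpolyC_eq0.
  exact: (det_hankel_neq0 p_monic p_size p_orth omega_neq0).
- apply/prodf_neq0 => i _; apply/prodf_neq0 => j lt_ij.
  (* The coefficient of the monomial [U_(i)] separates ['X_i] from ['X_j]. *)
  rewrite subr_eq0; apply/eqP => /mpolyP/(_ U_(i)%MM).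
  rewrite !mcoeffXU eqxx.
  have -> : (j == i) = false by apply: gtn_eqF.
  by move/eqP; rewrite oner_eq0.
(* Negating the variables reverses each difference, so the Vandermonde product adds no sign. *)
have -> : \prod_(i < d) \prod_(j < d | (i < j)%N) ('X_i - 'X_j)
          = \prod_(i < d) \prod_(j < d | (i < j)%N) (y j - y i).
  apply: eq_bigr => i _; apply: eq_bigr => j _.
  by rewrite /y opprK addrC.
have -> : (\det (\matrix_(i < n, j < n) moment L (i + j)%N))%:MP
          = \det (\matrix_(i < n, j < n) mu (i + j)%N) :> R.
  rewrite -det_map_mx; congr (\det _).
  by apply/matrixP => i j; rewrite !mxE.
set numL := \det _.
have -> : numL = \det (\matrix_(i < n, j < n)
    moment_form mu ((\prod_(l < d) ('X - (y l)%:P)) * 'X^(i + j))).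
  (* [umbral] unfolds to the moment form of the constants [mu], and each factor x_l + X is X -
     y_l. *)
  congr (\det _); apply/matrixP => i j; rewrite !mxE /umbral.
  congr (moment_form mu _); rewrite mulrC; congr (_ * _).
  by apply: eq_bigr => l _; rewrite /y polyCN opprK addrC.
exact: main.
Qed.
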